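(* Let $k\ge3$ be an integer, and let $\mathcal G_k$ be the class of all $2$-connected graphs $G$ with $\chi(G)=k+1$ that contain no $K_{k+1}$ and have average degree at most $2k$. Then: (1) For every integer $b\ge1$, the $k$-bad odd cycles do not have the $1/b$-integral Erdős–Pósa property, even on $\mathcal G_k$: there is no nondecreasing function $f\colon\mathbb N_0\to\mathbb N_0$ such that $\tau_k(G)\le f\bigl(\nu_k^{1/b}(G)\bigr)$ for every $G\in\mathcal G_k$. (2) The $k$-bad odd cycles do not have the fractional Erdős–Pósa property on $\mathcal G_k$: there is no nondecreasing function $f\colon\mathbb N_0\to\mathbb N_0$ such that $\tau_k(G)\le f\bigl(\lceil\nu_k^*(G)\rceil\bigr)$ for every $G\in\mathcal G_k$.
   Context: All graphs are finite and simple. $\chi$ denotes chromatic number. An odd cycle $C$ of a graph $G$ (a cycle subgraph of odd length, not necessarily induced) is called $k$-bad if $\chi(G[V(C)])\ge k+1$, where $G[V(C)]$ is the subgraph of $G$ induced by $V(C)$. $\mathcal C_k(G)$ denotes the family of $k$-bad odd cycles of $G$. - $\tau_k(G)$ is the minimum size of a set $X\subseteq V(G)$ meeting $V(C)$ for every $C\in\mathcal C_k(G)$. - For an integer $b\ge1$, $\nu_k^{1/b}(G)$ is the maximum cardinality of a set of distinct cycles from $\mathcal C_k(G)$ such that every vertex of $G$ lies in at most $b$ of them. - $\nu_k^*(G)$ is the fractional packing number of the hypergraph with edges $\mathcal F=\{V(C):C\in\mathcal C_k(G)\}$ on $V(G)$, i.e. the maximum of $\sum_{F\in\mathcal F}y_F$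 over real $y_F\ge0$ with $\sum_{F\ni v}y_F\le1$ for every $v\in V(G)$. The $1/b$-integral (respectively fractional) Erdős–Pósa property of $k$-bad odd cycles on a class of graphs is the existence of a nondecreasing $f\colon\mathbb N_0\to\mathbb N_0$ with $\tau_k(G)\le f(\nu_k^{1/b}(G))$ (respectively $\tau_k(G)\le f(\lceil\nu_k^*(G)\rceil)$) for every $G$ in the class. *)

(* Defs.v *)
From HB Require Import structures.
From mathcomp Require Import classical_sets reals.
From mathcomp Require Import all_boot all_order all_algebra.

Set Implicit Arguments.
Unset Strict Implicit.
Unset Printing Implicit Defensive.

Record sgraph := SGraph {
  vertex :> finType;
  adj : rel vertex;
  adj_sym : symmetric adj;
  adj_irrefl : irreflexive adj
}.

Section Induced.
Variables (G : sgraph) (S : {set G}).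

Definition induced_adj : rel {x : G | x \in S} :=
  fun x y => adj (val x) (val y).

Lemma induced_adj_sym : symmetric induced_adj.
Proof. by move=> x y; apply: adj_sym. Qed.

Lemma induced_adj_irrefl : irreflexive induced_adj.
Proof. by move=> x; apply: adj_irrefl. Qed.

Definition induced : sgraph := SGraph induced_adj_sym induced_adj_irrefl.

End Induced.

Definition colorable (G : sgraph) (q : nat) : bool :=
  [exists c : {ffun G -> 'I_q}, [forall x, forall y, adj x y ==> (c x != c y)]].

Lemma ex_colorable (G : sgraph) : exists q, colorable G q.
Proof.
exists #|G|; apply/existsP; exists [ffun x => enum_rank x].
apply/'forall_forallP => x y; apply/implyP; rewrite !ffunE.
by apply: contraTneq => /enum_rank_inj->; rewrite adj_irrefl.
Qed.

Definition chi (G : sgraph) : nat := ex_minn (ex_colorable G).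

Definition connected (G : sgraph) : Prop :=
  0 < #|G| /\ forall x y : G, connect (@adj G) x y.

Definition two_connected (G : sgraph) : Prop :=
  2 < #|G| /\
  forall X : {set G}, #|X| < 2 -> connected (induced (~: X)).

Definition has_clique (G : sgraph) (q : nat) : Prop :=
  exists2 S : {set G}, #|S| = q & {in S &, forall x y, x != y -> adj x y}.

Definition degree (G : sgraph) (x : G) : nat := #|[set y | adj x y]|.

Definition avg_degree (G : sgraph) : rat :=
  ((\sum_(x : G) degree x)%N%:R / #|G|%:R)%R.

(* A cycle subgraph is represented by its edge set, so that two cycles with the
   same vertex set but different edges are distinct; as a cycle has no isolated
   vertices, its vertex set is the union (cover) of its edges, and its length
   is the number of its edges. *)
Definition cycle_edges (G : sgraph) (c : seq G) : {set {set G}} :=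
  [set [set x; next c x] | x in c].

(* Bounding the size of the vertex sequence by #|G| loses nothing, since its
   entries are distinct. *)
Definition is_cycle (G : sgraph) (C : {set {set G}}) : bool :=
  [exists c : #|G|.-bseq G,
    [&& 2 < size c, ucycleb (@adj G) c & C == cycle_edges c]].

Definition bad_odd_cycles (k : nat) (G : sgraph) : {set {set {set G}}} :=
  [set C | [&& is_cycle C, odd #|C| & k.+1 <= chi (induced (cover C))]].

Definition hitting_set (k : nat) (G : sgraph) (X : {set G}) : bool :=
  [forall C in bad_odd_cycles k G, X :&: cover C != set0].

Lemma hitting_setT (k : nat) (G : sgraph) : hitting_set k [set: G].
Proof.
apply/forall_inP => C; rewrite inE => /and3P[/existsP[c]].
case/and3P=> c_gt2 _ /eqP-> _ _; rewrite setTI.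
case: (bseqval c) c_gt2 => [|x s] // _.
apply/set0Pn; exists x; apply/bigcupP.
exists [set x; next (x :: s) x]; last by rewrite !inE eqxx.
by apply/imsetP; exists x; rewrite ?mem_head.
Qed.

Definition tau (k : nat) (G : sgraph) : nat :=
  #|[arg min_(X < [set: G] | hitting_set k X) #|X|]|.

Definition packing (k b : nat) (G : sgraph) (P : {set {set {set G}}}) : bool :=
  (P \subset bad_odd_cycles k G) &&
  [forall v : G, #|[set C in P | v \in cover C]| <= b].

Definition nu (k b : nat) (G : sgraph) : nat :=
  \max_(P : {set {set {set G}}} | packing k b P) #|P|.

Definition bad_hyperedges (k : nat) (G : sgraph) : {set {set G}} :=
  [set cover C | C in bad_odd_cycles k G].

Definition frac_packing (R : realType) (k : nat) (G : sgraph)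
    (y : {set G} -> R) : Prop :=
  (forall F, F \in bad_hyperedges k G -> 0 <= y F)%R /\
  (forall v : G, \sum_(F in bad_hyperedges k G | v \in F) y F <= 1)%R.

(* The supremum is a maximum: the values y F with F a hyperedge range over a
   nonempty compact polytope. *)
Definition frac_nu (R : realType) (k : nat) (G : sgraph) : R :=
  sup [set (\sum_(F in bad_hyperedges k G) y F)%R
        | y in [set y : {set G} -> R | frac_packing k y]]%classic.

Definition integral_Erdos_Posa (k b : nat) (class : sgraph -> Prop) : Prop :=
  exists f : nat -> nat, {homo f : m n / m <= n} /\
    forall G : sgraph, class G -> tau k G <= f (nu k b G).

(* frac_nu is nonnegative, so absz only turns its ceiling into a nat. *)
Definition frac_Erdos_Posa (R : realType) (k : nat) (class : sgraph -> Prop) :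
    Prop :=
  exists f : nat -> nat, {homo f : m n / m <= n} /\
    forall G : sgraph, class G -> tau k G <= f `|Num.ceil (frac_nu R k G)|%N.

Definition graph_class (k : nat) (G : sgraph) : Prop :=
  [/\ two_connected G, chi G = k.+1, ~ has_clique G k.+1
    & (avg_degree G <= (2 * k)%:R)%R].

(* Main.v *)
Require Import Defs.
From mathcomp Require Import classical_sets reals.
From mathcomp Require Import all_boot all_order all_algebra perm zify.

(** We construct, for every [k >= 3] and every [m], a graph of the class in
    which no [m] vertices hit all the [k]-bad odd cycles, although some set [P]
    of vertices is such that every [k]-bad odd cycle contains more than half of
    [P].  Uniform weights on [P] then show that the fractional packing number
    is at most [2], and that the [1/b]-integral one is at most [2 * b]
    ([frac_packing_thick], [nu_thick]), so no function [f] can bound [tau].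

    The set [P] consists of [2 * k * m] points, and the model is the hypergraph
    of all the [m.+1]-subsets of [P]: a part of [P] can be [k]-colored without
    monochromatic hyperedge if and only if it has at most [k * m] points.  So
    non-colorability requires more than half of the points, but it survives the
    deletion of any [m] of them.  The core graph turns the hypergraph into a
    graph: gadgets, made of a chain of [k]-cliques, forbid that a given sequence
    of [m.+1] points be monochromatic and forbid nothing else
    ([few_points_colorable], [core_robust]).  The core contains no clique with
    [k.+1] vertices and is [k.+1]-colorable.

    It remains to run odd cycles through whatever is left after a deletion, and
    to get the degree and connectivity conditions.  For this every pair of
    vertices of the core is joined by many paths of length two.  Their middle
    vertices have degree two, so they affect neither [k]-colorability nor
    large cliques, they bring the average degree down to at most [6], and they
    allow an odd cycle to visit all the remaining vertices of the core
    ([padded_hitting_set]). *)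

Set Implicit Arguments.
Unset Strict Implicit.
Unset Printing Implicit Defensive.
Import Order.TTheory GRing.Theory Num.Theory.

(** * Colorings, degrees and cycles *)

Definition colorable_on (G : sgraph) (S : {set G}) (q : nat) : Prop :=
  exists c : G -> 'I_q, {in S &, forall x y, adj x y -> c x != c y}.

Lemma colorableP (G : sgraph) q :
  reflect (exists c : G -> 'I_q, forall x y, adj x y -> c x != c y)
          (colorable G q).
Proof.
apply: (iffP existsP) => [[c /forallP cP]|[c cP]].
  by exists c => x y; move/forallP/(_ y)/implyP: (cP x).
exists [ffun x => c x]; apply/forallP => x; apply/forallP => y.
by apply/implyP; rewrite !ffunE; apply: cP.
Qed.

Lemma colorable_inducedP (G : sgraph) (S : {set G}) q :
  reflect (colorable_on S q.+1) (colorable (induced S) q.+1).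
Proof.
apply: (iffP (colorableP _ _)) => [[c cP]|[c cP]]; last first.
  by exists (c \o val) => x y; apply: cP; apply: valP.
exists (fun x => if insub x is Some u then c u else ord0) => x y xS yS xy.
by rewrite !insubT; apply: cP.
Qed.

Lemma leq_colorable (G : sgraph) q r :
  q <= r -> colorable G q -> colorable G r.
Proof.
move=> qr /colorableP[c cP]; apply/colorableP.
by exists (widen_ord qr \o c) => x y /cP; apply: contraNneq => -[/val_inj->].
Qed.

Lemma chi_gt (G : sgraph) q : (q < chi G) = ~~ colorable G q.
Proof.
rewrite /chi; case: ex_minnP => n Gn minn.
by rewrite ltnNge; congr negb; apply/idP/idP => [/leq_colorable/(_ Gn)|/minn].
Qed.

Lemma sub_colorable_on (G : sgraph) (A B : {set G}) q :
  A \subset B -> colorable_on B q -> colorable_on A q.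
Proof.
move=> /subsetP AB [c cP]; exists c => x y xA yA; apply: cP; exact: AB.
Qed.

Lemma degreeE (G : sgraph) (x : G) : degree x = \sum_y adj x y.
Proof.
rewrite /degree cardsE -sum1_card big_mkcond; apply: eq_bigr => y _.
have -> : (y \in adj x) = adj x y by []. by case: (adj x y).
Qed.

Section CycleEdges.
Variables (G : sgraph) (c : seq G).
Hypotheses (c_uniq : uniq c) (c_gt2 : 2 < size c).

Lemma cover_cycle_edges : cover (cycle_edges c) = [set x in c].
Proof.
apply/setP => y; rewrite inE; apply/bigcupP/idP => [[_ /imsetP[x xc ->]]|yc].
  by rewrite !inE => /orP[] /eqP->; rewrite ?mem_next.
by exists [set y; next c y]; [apply: imset_f | rewrite !inE eqxx].
Qed.

(** Two consecutive edges of a cycle of length at least three differ; this is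
    what makes the edges of such a cycle as numerous as its vertices. *)
Lemma next_next_neq x : x \in c -> next c (next c x) != x.
Proof.
move=> xc; have [i s cE] := rot_to xc.
rewrite -!(next_rot i c_uniq) cE.
have: uniq (x :: s) by rewrite -cE rot_uniq.
have: 2 < size (x :: s) by rewrite -cE size_rot.
case: s {cE} => [|y [|z s]] //= _; rewrite !inE !negb_or eqxx.
by rewrite ![x == _]eq_sym => /andP[/and3P[/negPf-> xz _] _]; rewrite eqxx.
Qed.

Lemma card_cycle_edges : #|cycle_edges c| = size c.
Proof.
rewrite card_in_imset ?(card_uniqP c_uniq) // => x y xc yc /setP eq_xy.
apply/eqP.
have := eq_xy x; rewrite !inE eqxx /= => /esym/orP[//|/eqP x_ny].
have := eq_xy (next c x); rewrite !inE eqxx orbT => /esym/orP[/eqP nx_y|].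
  by have := next_next_neq xc; rewrite nx_y -x_ny eqxx.
by rewrite -x_ny => /eqP nx_x; have := next_next_neq xc; rewrite !nx_x eqxx.
Qed.

Lemma cycle_edges_is_cycle : cycle (@adj G) c -> is_cycle (cycle_edges c).
Proof.
move=> c_cycle; have cG : size c <= #|G|.
  by rewrite -(card_uniqP c_uniq) max_card.
apply/existsP; exists (Bseq cG); rewrite /= c_gt2 eqxx andbT.
by rewrite /ucycleb c_cycle.
Qed.

End CycleEdges.

Section Avoid.
Variable q : nat.
Implicit Types a b : 'I_q.+3.

Definition avoid a b : 'I_q.+3 := odflt a [pick c | (c != a) && (c != b)].

Lemma avoidP a b : avoid a b != a /\ avoid a b != b.
Proof.
rewrite /avoid; case: pickP => [c /andP[]//|none].
have: #|[set: 'I_q.+3]| <= #|[set a; b]|.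
  apply/subset_leq_card/subsetP => c _; move: (none c).
  by rewrite !inE; case: (c == a); case: (c == b).
by rewrite cardsT card_ord cards2; case: (a != b).
Qed.

End Avoid.

(** * The core graph *)

Section Colors.
Variable q : nat.
Implicit Types a b c i : 'I_q.+3.

Definition second : 'I_q.+3 := lift ord0 ord0.

Lemma ord_eq0 i : i == 0 :> nat -> i = ord0.
Proof. by move/eqP => i0; apply: val_inj. Qed.

Lemma ord_eq1 i : i == 1 :> nat -> i = second.
Proof. by move/eqP => i1; apply: val_inj. Qed.

(** A coloring of one row of a gadget.  The row is a clique whose vertex
    [ord0] gets the color [c], whose vertex [second] has a neighbor of color
    [b], and whose remaining vertices have a common neighbor of color [a]. *)
Definition row_coloring a b c : {perm 'I_q.+3} :=
  (tperm ord0 c *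
   tperm (tperm ord0 c second) (if a == c then avoid a b else a))%g.

(** All colors occur on a row, so [a] is either the color of [ord0] or that of
    [second].  In the first case [second] can take any color but [a] and [b];
    in the second case [a <> b] leaves [second] free to take [a].  So if the
    inputs [a] and [b] differ then the output [c] is arbitrary. *)
Lemma row_coloringP a b c : (a = b -> c = a) ->
  let r := row_coloring a b c in
  [/\ r ord0 = c, r second != b & forall i : 'I_q.+3, 1 < i -> r i != a].
Proof.
move=> abc r; have [av_a av_b] := avoidP a b.
set z := if a == c then avoid a b else a.
have zc : z != c by rewrite /z; case: (eqVneq a c) => [<-|].
have r0 : r ord0 = c.
  have wc : tperm ord0 c second != c.
    by rewrite -(inj_eq (@perm_inj _ (tperm ord0 c))) tpermK tpermR.
  by rewrite permM tpermL; apply: tpermD.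
have r1 : r second = z by rewrite permM tpermL.
split=> // [|i i_gt1].
  by rewrite r1 /z; case: (eqVneq a c) => // ac; apply: contraNneq ac => /abc->.
have [ac|ac] := eqVneq a c.
  by rewrite ac -r0 (inj_eq perm_inj); apply: contraTneq i_gt1 => ->.
have <- : r second = a by rewrite r1 /z (negPf ac).
by rewrite (inj_eq perm_inj); apply: contraTneq i_gt1 => ->.
Qed.

End Colors.

Section Core.
Variables q m : nat.

Definition points := 'I_(2 * (q.+3 * m)).

(** An injective sequence of [m.+1] points stands for a set of [m.+1] points
    with an order along which its gadget is built. *)
Definition sequences := {e : {ffun 'I_m.+1 -> points} | injectiveb e}.

Lemma sequence_inj (e : sequences) : injective (sval e).
Proof. exact: injectiveP (valP e). Qed.

(** Each sequence has [m.+1] gadgets, so that deleting [m] vertices leaves one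
    of them intact. *)
Definition gadgets := (sequences * 'I_m.+1)%type.
Definition core_vertex := (points + gadgets * ('I_m * 'I_q.+3))%type.

(** A gadget consists of [m] rows, each a clique on ['I_q.+3].  Row [j] reads
    two input colors and passes one on: its vertices from the third on are
    joined to the point [j.+1] of the sequence, its second vertex to the
    first vertex of the previous row (to the point [0] if there is none), and
    its first vertex carries the output.  The output of the last row is joined
    to the point [0]. *)
Definition point_adj (p : points) (g : gadgets) (v : 'I_m * 'I_q.+3) : bool :=
  let: (j, i) := v in
  [|| (1 < i) && (p == sval g.1 (lift ord0 j)),
      [&& i == 1 :> nat, j == 0 :> nat & p == sval g.1 ord0]
    | [&& i == 0 :> nat, j.+1 == m & p == sval g.1 ord0]].

Definition chain_step (v w : 'I_m * 'I_q.+3) : bool :=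
  [&& v.1.+1 == w.1, v.2 == 0 :> nat & w.2 == 1 :> nat].

Definition chain_adj (v w : 'I_m * 'I_q.+3) : bool :=
  [|| (v.1 == w.1) && (v.2 != w.2), chain_step v w | chain_step w v].

Definition core_adj : rel core_vertex := fun x y =>
  match x, y with
  | inl _, inl _ => false
  | inl p, inr (g, v) => point_adj p g v
  | inr (g, v), inl p => point_adj p g v
  | inr (g, v), inr (h, w) => (g == h) && chain_adj v w
  end.

Lemma core_adj_sym : symmetric core_adj.
Proof.
move=> [p|[g v]] [p'|[g' v']] //=.
rewrite /chain_adj [g == _]eq_sym [v.1 == _]eq_sym [v.2 == _]eq_sym.
by rewrite [chain_step v _ || _]orbC.
Qed.

Lemma core_adj_irrefl : irreflexive core_adj.
Proof.
move=> [p|[g [j i]]] //=.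
by rewrite /chain_adj /chain_step /= !eqxx orbb -(addn1 j) -{2}(addn0 j) eqn_add2l.
Qed.

Definition core : sgraph := SGraph core_adj_sym core_adj_irrefl.

(** One color more than the size of a row lets all the points share the extra
    color, so that the points constrain no gadget. *)
Definition base_color (x : core) : 'I_q.+4 :=
  if x is inr (_, (_, i)) then lift ord_max i else ord_max.

Lemma base_color_proper (x y : core) : adj x y -> base_color x != base_color y.
Proof.
case: x y => [p|[g [j i]]] [p'|[h [j' i']]] //=; rewrite ?neq_lift //.
  by move=> _; rewrite eq_sym neq_lift.
rewrite (inj_eq (@lift_inj _ _)) => /andP[_] /or3P[/andP[]//||];
by case/and3P=> _ /eqP i0 /eqP i1; apply/eqP => ii; move: i0 i1; rewrite ii => ->.
Qed.

Lemma core_colorable : colorable core q.+4.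
Proof. by apply/colorableP; exists base_color; apply: base_color_proper. Qed.

(** A clique with [q.+4] vertices uses each base color once.  So it contains
    one point, together with a second and a third row vertex adjacent to it in
    the same gadget; but these are only adjacent to different entries of an
    injective sequence. *)
Lemma core_no_clique : ~ has_clique core q.+4.
Proof.
case=> S cardS cliqueS.
have inj : {in S &, injective base_color}.
  move=> x y xS yS /eqP; apply: contraTeq => xy.
  exact/base_color_proper/cliqueS.
have onto a : exists2 x, x \in S & base_color x = a.
  have: a \in base_color @: S.
    suff -> : base_color @: S = setT by [].
    by apply/eqP; rewrite eqEcard subsetT cardsT card_ord card_in_imset // cardS /=.
  by case/imsetP=> x; exists x.
have [[p|[? [? i]]] pS] := onto ord_max; last first.
  by move/eqP; rewrite eq_sym (negPf (neq_lift _ _)).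
move=> _.
have pt_adj i : exists g j, [/\ inr (g, (j, i)) \in S & point_adj p g (j, i)].
  have [[p'|[g [j i']]] xS /=] := onto (lift ord_max i).
    by move/eqP; rewrite (negPf (neq_lift _ _)).
  move/lift_inj => <-; exists g, j; split=> //.
  exact: (cliqueS _ _ pS xS).
have [g [j [gS pg]]] := pt_adj (inord 1).
have [h [l [hS ph]]] := pt_adj (inord 2).
have gh : g = h.
  have := cliqueS _ _ gS hS; rewrite /= => H.
  have : (inr (g, (j, inord 1)) : core) != inr (h, (l, inord 2)).
    by apply/eqP => -[_ _ /(congr1 (@nat_of_ord _))]; rewrite !inordK.
  by move/H => /andP[/eqP].
move: pg ph; rewrite -{}gh /= !inordK //= !orbF => /andP[_ /eqP->].
by rewrite (inj_eq (@sequence_inj _)) (negPf (neq_lift _ _)).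
Qed.

(** Colors [f] prescribed on the entries of a sequence extend to its gadget
    unless they are all equal. *)
Section VirtualColors.
Variable f : 'I_m.+1 -> 'I_q.+3.

(** The color passed on after reading the entries up to [l]: it has to be the
    common color as long as no other one has been read; afterwards it is kept
    away from the next entry, which leaves every later row free.  There is no
    next entry for [l = m], where the value of [inord] is irrelevant. *)
Definition chain_color (l : nat) : 'I_q.+3 :=
  if [forall l' : 'I_m.+1, (l' <= l) ==> (f l' == f ord0)] then f ord0
  else avoid (f ord0) (f (inord l.+1)).

Definition gadget_color (v : 'I_m * 'I_q.+3) : 'I_q.+3 :=
  row_coloring (f (lift ord0 v.1)) (chain_color v.1) (chain_color v.1.+1) v.2.

Lemma chain_color0 : chain_color 0 = f ord0.
Proof.
rewrite /chain_color ifT //; apply/forallP => l; apply/implyP.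
by rewrite leqn0 => /eqP l0; apply/eqP; congr f; apply: val_inj.
Qed.

Lemma chain_color_max : (exists l, f l != f ord0) -> chain_color m != f ord0.
Proof.
case=> l fl; rewrite /chain_color ifN.
  by case: (avoidP (f ord0) (f (inord m.+1))).
by apply/negP => /forallP/(_ l); rewrite -ltnS ltn_ord (negPf fl).
Qed.

Lemma chain_color_step (j : 'I_m) :
  f (lift ord0 j) = chain_color j -> chain_color j.+1 = f (lift ord0 j).
Proof.
have lE : inord j.+1 = lift ord0 j :> 'I_m.+1.
  by apply: val_inj; rewrite /= inordK // ltnS.
rewrite [chain_color j]/chain_color lE; case: ifP => [/forallP mono fj|_ fj].
  rewrite /chain_color ifT //; apply/forallP => l; apply/implyP.
  rewrite leq_eqVlt => /orP[/eqP lj|]; last by rewrite ltnS; apply/implyP.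
  suff -> : l = lift ord0 j by rewrite fj.
  exact: val_inj.
by case: (avoidP (f ord0) (f (lift ord0 j))) => _; rewrite -fj eqxx.
Qed.

Lemma gadget_rowP (j : 'I_m) :
  [/\ gadget_color (j, ord0) = chain_color j.+1,
      gadget_color (j, second q) != chain_color j
    & forall i : 'I_q.+3, 1 < i -> gadget_color (j, i) != f (lift ord0 j)].
Proof. exact/row_coloringP/chain_color_step. Qed.

Lemma gadget_color_step v w :
  chain_step v w -> gadget_color v != gadget_color w.
Proof.
case: v w => j i [j' i'] /and3P[/= /eqP jj /ord_eq0-> /ord_eq1->].
have [-> _ _] := gadget_rowP j; have [_ + _] := gadget_rowP j'.
by rewrite -jj eq_sym.
Qed.

Lemma gadget_color_proper v w :
  chain_adj v w -> gadget_color v != gadget_color w.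
Proof.
case/or3P=> [|/gadget_color_step//|/gadget_color_step]; last by rewrite eq_sym.
case: v w => j i [j' i'] /= /andP[/eqP<- ii'].
by rewrite /gadget_color (inj_eq perm_inj).
Qed.

Lemma gadget_color_point (g : gadgets) v l : (exists l, f l != f ord0) ->
  point_adj (sval g.1 l) g v -> gadget_color v != f l.
Proof.
move=> non_mono; case: v => j i.
have e_eq l' : (sval g.1 l == sval g.1 l') = (l == l').
  by rewrite (inj_eq (@sequence_inj _)).
have [r0 r1 r2] := gadget_rowP j.
rewrite /= !e_eq => /or3P[/andP[i1 /eqP->]|/and3P[/ord_eq1-> /eqP j0 /eqP->]|].
- exact: r2.
- by move: r1; rewrite j0 chain_color0.
by case/and3P=> /ord_eq0-> /eqP jm /eqP->; rewrite r0 jm chain_color_max.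
Qed.

End VirtualColors.

(** Split the remaining points into [q.+3] color classes of at most [m] points
    each: no class contains a whole sequence, so all gadgets can be colored. *)
Lemma few_points_colorable (S : {set core}) : 0 < m ->
  #|[set p : points | inl p \in S]| <= q.+3 * m -> colorable_on S q.+3.
Proof.
move=> m_gt0; set A := [set p : points | _] => cardA.
pose rank p := index p (enum A).
have rank_lt p : p \in A -> rank p < q.+3 * m.
  by move=> pA; apply: leq_trans cardA; rewrite cardE index_mem mem_enum.
pose col p : 'I_q.+3 := inord (rank p %/ m).
have col_nonmono (e : sequences) : (forall l, sval e l \in A) ->
    exists l, col (sval e l) != col (sval e ord0).
  move=> eA; apply/existsP; apply: contraT => /existsPn mono.
  have rank_div l : rank (sval e l) %/ m = rank (sval e ord0) %/ m.
    have /negPn/eqP/(congr1 val) := mono l.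
    by rewrite /= !inordK // ltn_divLR // rank_lt.
  pose h l : 'I_m := Ordinal (ltn_pmod (rank (sval e l)) m_gt0).
  suff /leq_card : injective h by rewrite !card_ord ltnn.
  move=> l l' /(congr1 val) /= hl; apply: (@sequence_inj e).
  apply: (@index_inj _ (sval e l) (enum A)); rewrite ?mem_enum //.
  by rewrite -/(rank _) (divn_eq (rank _) m) hl rank_div -(rank_div l') -divn_eq.
(* A missing entry of a sequence imposes nothing, so it can be given a color
   that makes the sequence non-monochromatic. *)
have virtual (e : sequences) : exists f : {ffun 'I_m.+1 -> 'I_q.+3},
    (forall l, sval e l \in A -> f l = col (sval e l)) /\ exists l, f l != f ord0.
  have [/forallP eA|/forallPn[l0 l0A]] := boolP [forall l, sval e l \in A].
    exists [ffun l => col (sval e l)]; split=> [l _|]; first by rewrite ffunE.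
    by have [l ne] := col_nonmono _ eA; exists l; rewrite !ffunE.
  have [l1 l10] : exists l1, l1 != l0.
    by exists (lift l0 (Ordinal m_gt0)); rewrite eq_sym neq_lift.
  pose z := col (sval e l1).
  pose f := [ffun l => if l == l0 then avoid z z else col (sval e l)].
  exists f; split=> [l lA|].
    by rewrite ffunE ifN //; apply: contraNneq l0A => <-.
  have f01 : f l0 != f l1.
    by rewrite !ffunE eqxx (negPf l10); case: (avoidP z z).
  have [f00|] := eqVneq (f l0) (f ord0); last by exists l0.
  by exists l1; rewrite -f00 eq_sym.
have /fin_all_exists[F FP] := virtual.
exists (fun x => match x with
  | inl p => col p
  | inr (g, v) => gadget_color (F g.1) v
  end).
have pt p g v : p \in A -> point_adj p g v -> gadget_color (F g.1) v != col p.
  have [Fcol Fnm] := FP g.1 => pA pv.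
  have [l pE] : exists l, p = sval g.1 l.
    by case: v pv => j i /or3P[/andP[]|/and3P[]|/and3P[]] => *;
      eexists; apply/eqP; eassumption.
  by move: pA pv; rewrite pE => lA; rewrite -(Fcol _ lA); apply: gadget_color_point.
move=> [p|[g v]] [p'|[h w]] //= xS yS.
- by rewrite eq_sym; apply: pt; rewrite inE.
- by apply: pt; rewrite inE.
by case/andP=> /eqP<-; apply: gadget_color_proper.
Qed.

(** More than [q.+3 * m] points remain, so some [m.+1] of them have the same
    color [a]; as a row uses all the colors and [a] is forbidden on all its
    vertices but the first, [a] propagates along an intact gadget and collides
    with the point [0] of its sequence. *)
Lemma core_robust (Y : {set core}) : 0 < m -> #|Y| <= m ->
  ~ colorable_on (~: Y) q.+3.
Proof.
move=> m_gt0 cardY [c cP].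
pose A := [set p : points | inl p \notin Y].
have cardA : q.+3 * m < #|A|.
  have <- : ~: [set p : points | inl p \in Y] = A by apply/setP => p; rewrite !inE.
  have := cardsC [set p : points | inl p \in Y]; rewrite card_ord.
  have : #|[set p : points | inl p \in Y]| <= #|Y|.
    rewrite -(card_imset _ (@inl_inj points (gadgets * ('I_m * 'I_q.+3)))).
    by apply/subset_leq_card/subsetP => _ /imsetP[p pY ->]; move: pY; rewrite inE.
  nia.
have [a big] : exists a, m < #|[set p in A | c (inl p) == a]|.
  apply/existsP; apply: contraT => /existsPn small.
  suff: #|A| <= q.+3 * m by rewrite leqNgt cardA.
  rewrite -sum1_card (partition_big (fun p => c (inl p)) predT) //=.
  apply: leq_trans (_ : \sum_(a < q.+3) m <= _); last first.
    by rewrite sum_nat_const card_ord.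
  apply: leq_sum => a _.
  rewrite sum1_card leqNgt; apply: contra (small a) => /leq_trans; apply.
  by rewrite cardsE.
have [e eP] : exists e : sequences, forall l,
    inl (sval e l) \in ~: Y /\ c (inl (sval e l)) = a.
  pose f := [ffun l : 'I_m.+1 => enum_val (widen_ord big l)].
  have f_inj : injectiveb f.
    by apply/injectiveP => l l'; rewrite !ffunE => /enum_val_inj[/val_inj].
  exists (exist _ f f_inj) => l; rewrite /= ffunE.
  by have := enum_valP (widen_ord big l); rewrite !inE => /andP[? /eqP].
have [s sP] : exists s, forall v, inr ((e, s), v) \in ~: Y.
  have [/existsP[s /forallP]|/existsPn hit] :=
    boolP [exists s : 'I_m.+1, forall v, (inr ((e, s), v) : core) \in ~: Y].
    by exists s.
  have /fin_all_exists[h hP] s : exists v, (inr ((e, s), v) : core) \in Y.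
    by have /forallPn[v] := hit s; rewrite inE negbK; exists v.
  pose hv s : core := inr ((e, s), h s).
  suff: #|'I_m.+1| <= #|Y| by rewrite card_ord leqNgt ltnS cardY.
  have hv_inj : injective hv by move=> s s' [].
  rewrite -(card_imset _ hv_inj).
  apply/subset_leq_card/subsetP => _ /imsetP[s _ ->]; exact: hP.
pose g : gadgets := (e, s).
have pointN l v : point_adj (sval e l) g v -> c (inr (g, v)) != a.
  by have [eY <-] := eP l => adj_v; apply: (cP _ _ (sP v) eY).
have row (j : 'I_m) : c (inr (g, (j, second q))) != a ->
    c (inr (g, (j, ord0))) = a.
  move=> c1; pose r i := c (inr (g, (j, i))).
  have r_inj : injective r.
    move=> i i' /eqP; apply: contraTeq => ii'; apply: (cP _ _ (sP _) (sP _)).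
    by rewrite /= eqxx /chain_adj /= eqxx ii'.
  have /imageP[i _ ai] : a \in codom r by apply: inj_card_onto.
  rewrite [RHS]ai; congr (c (inr (g, (j, _)))); apply: val_inj => /=.
  have [i_lt1|i_gt1|i1] := ltngtP i 1.
  - by move: i_lt1; rewrite ltnS leqn0 => /eqP.
  - have := pointN (lift ord0 j) (j, i); rewrite /= i_gt1 eqxx /= => /(_ isT).
    by rewrite -/(r i) -ai eqxx.
  by move: c1; rewrite -(ord_eq1 (i := i)) ?i1 // -/(r i) -ai eqxx.
have chain (j : nat) (jm : j < m) : c (inr (g, (Ordinal jm, ord0))) = a.
  elim: j jm => [|j IHj] jm; apply: row.
    by apply: (pointN ord0); rewrite /= eqxx.
  rewrite -(IHj (ltnW jm)) eq_sym; apply: (cP _ _ (sP _) (sP _)).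
  by rewrite /= eqxx /chain_adj /chain_step /= !eqxx /= orbT.
have m1 : m.-1 < m by rewrite prednK.
have := pointN ord0 (Ordinal m1, ord0).
by rewrite chain /= prednK // !eqxx => /(_ isT).
Qed.

End Core.

(** * Padding with vertices of degree two *)

Section Padding.
Variables (H : sgraph) (T : nat).

Definition other (u : H) : H := odflt u [pick v | v != u].

(** The connectors indexed by a pair [(u, u)] are attached to a second vertex
    as well, since a vertex of degree one would destroy 2-connectivity. *)
Definition far (u v : H) : H := if u == v then other u else v.

(** Every ordered pair of distinct vertices of [H] gets its own [T] connecting
    paths of length two. *)
Definition padded_vertex := (H + H * H * 'I_T)%type.

Definition ends (z : H * H * 'I_T) : pred H := pred2 z.1.1 (far z.1.1 z.1.2).

Definition padded_adj : rel padded_vertex := fun x y =>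
  match x, y with
  | inl u, inl v => adj u v
  | inl u, inr z => ends z u
  | inr z, inl u => ends z u
  | inr _, inr _ => false
  end.

Lemma padded_adj_sym : symmetric padded_adj.
Proof. by move=> [u|z] [v|w] //=; apply: adj_sym. Qed.

Lemma padded_adj_irrefl : irreflexive padded_adj.
Proof. by move=> [u|z] //=; apply: adj_irrefl. Qed.

Definition padded : sgraph := SGraph padded_adj_sym padded_adj_irrefl.

Lemma far_neq u v : u != v -> far u v = v.
Proof. by rewrite /far => /negPf->. Qed.

Lemma far_diff u v : 1 < #|H| -> u != far u v.
Proof.
move=> H_gt1; rewrite /far; case: (eqVneq u v) => // _; rewrite /other.
case: (pickP (fun v => v != u)) => [w wu|none] /=; first by rewrite eq_sym.
suff: #|H| <= 1 by rewrite leqNgt H_gt1.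
rewrite -(card1 u); apply/subset_leq_card/subsetP => w _.
by move/negbFE: (none w).
Qed.

Lemma card_ends z : #|ends z| <= 2.
Proof. by rewrite card2; case: (_ != _). Qed.

Lemma fresh_connector (X : {set padded}) u v : #|X| < T ->
  exists s, inr (u, v, s) \notin X.
Proof.
move=> XT; apply/existsP; apply: contraLR XT => /existsPn used.
rewrite -leqNgt -[T]card_ord.
pose h s : padded := inr (u, v, s).
rewrite -(card_imset _ (_ : injective h)); last by move=> s s' [].
by apply/subset_leq_card/subsetP => _ /imsetP[s _ ->]; have /negPn := used s.
Qed.

(** Connectors have only two neighbors, so with three colors or more they never
    obstruct a coloring. *)
Definition extend_coloring q (c : H -> 'I_q.+3) (x : padded) : 'I_q.+3 :=
  match x with
  | inl u => c u
  | inr z => avoid (c z.1.1) (c (far z.1.1 z.1.2))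
  end.

Lemma extend_coloring_ends q (c : H -> 'I_q.+3) z u :
  ends z u -> extend_coloring c (inr z) != c u.
Proof.
have [a b] := avoidP (c z.1.1) (c (far z.1.1 z.1.2)).
by case/orP=> /eqP->.
Qed.

Lemma padded_colorable_on (S : {set padded}) q :
  colorable_on [set u | inl u \in S] q.+3 -> colorable_on S q.+3.
Proof.
case=> c cP; exists (extend_coloring c).
move=> [u|z] [v|w] xS yS //= adj_xy; last exact: extend_coloring_ends.
  by apply: cP; rewrite ?inE.
by rewrite eq_sym; apply: extend_coloring_ends.
Qed.

Lemma padded_colorable q : colorable H q.+3 -> colorable padded q.+3.
Proof.
case/colorableP=> c cP; apply/colorableP; exists (extend_coloring c).
move=> [u|z] [v|w] //= adj_xy; last exact: extend_coloring_ends.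
  exact: cP.
by rewrite eq_sym; apply: extend_coloring_ends.
Qed.

Lemma colorable_on_core (S : {set padded}) q :
  colorable_on S q -> colorable_on [set u | inl u \in S] q.
Proof. by case=> c cP; exists (c \o inl) => u v; rewrite !inE; apply: cP. Qed.

Lemma padded_no_clique q : 3 < q -> ~ has_clique H q -> ~ has_clique padded q.
Proof.
move=> q_gt3 noH [S cardS cliqueS].
have [|/existsPn no_z] := boolP [exists z, (inr z : padded) \in S].
  case/existsP=> z zS; have: #|S| <= 1 + #|ends z|.
    rewrite -(cards1 (inr z : padded)) -(card_imset _ (@inl_inj H (H * H * 'I_T))).
    apply: leq_trans (leq_card_setU _ _); apply/subset_leq_card/subsetP => x xS.
    rewrite !inE; have [//|x_z] := eqVneq x (inr z).
    have := cliqueS _ _ xS zS x_z; case: x {xS x_z} => [u|w] //= uz.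
    by apply: imset_f.
  by have := card_ends z; lia.
apply: noH; exists [set u | inl u \in S]; last first.
  by move=> u v; rewrite !inE => uS vS uv; apply: (cliqueS _ _ uS vS).
rewrite -cardS -(card_imset _ (@inl_inj H (H * H * 'I_T))); apply: eq_card => x.
apply/imsetP/idP => [[u + ->]|xS]; first by rewrite inE.
case: x xS => [u|z] xS; first by exists u; rewrite ?inE.
by have := no_z z; rewrite xS.
Qed.

(** One deleted vertex cannot kill all the connectors between two vertices of
    [H], nor both ends of a connector. *)
Lemma padded_two_connected : 1 < #|H| -> 1 < T -> two_connected padded.
Proof.
move=> H_gt1 T_gt1; split.
  by rewrite card_sum !card_prod card_ord; nia.
move=> X X_lt2.
have X_T : #|X| < T by apply: leq_trans X_lt2 _.
set G' := induced _.
have only_one x y : x \in X -> y \in X -> x = y.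
  by move=> xX yX; apply: (card_le1_eqP _ _ _ yX xX); rewrite -ltnS.
have step (x y : padded) (xP : x \in ~: X) (yP : y \in ~: X) :
    adj x y -> connect (@adj G') (exist _ x xP) (exist _ y yP).
  by move=> xy; apply: connect1.
have core_connect (u v : H) (uP : inl u \in ~: X) (vP : inl v \in ~: X) :
    connect (@adj G') (exist _ (inl u) uP) (exist _ (inl v) vP).
  have [uv|uv] := eqVneq u v.
    by subst v; rewrite (bool_irrelevance vP uP) connect0.
  have [s sX] := fresh_connector u v X_T.
  have zP : inr (u, v, s) \in ~: X by rewrite inE.
  apply: (connect_trans (step _ _ uP zP _)); first by rewrite /= /ends /= eqxx.
  by apply: step; rewrite /= /ends /= far_neq // eqxx orbT.
have to_core (x : G') : exists (u : H) (uP : inl u \in ~: X),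
    connect (@adj G') x (exist _ (inl u) uP).
  case: x => -[u|z] xP; first by exists u, xP; apply: connect0.
  have [u uz uP] : exists2 u, ends z u & (inl u : padded) \in ~: X.
    have [out|in1] := boolP ((inl z.1.1 : padded) \in ~: X).
      by exists z.1.1; rewrite // /ends /= eqxx.
    exists (far z.1.1 z.1.2); first by rewrite /ends /= eqxx orbT.
    move: in1; rewrite !inE negbK => in1; apply/negP => in2.
    have [eq_far] := only_one _ _ in1 in2.
    by have := far_diff z.1.1 z.1.2 H_gt1; rewrite -eq_far eqxx.
  by exists u, uP; apply: step.
split=> [|x y].
  have [x xX] : exists x, x \notin X.
    apply/existsP; apply: contraLR X_lt2 => /existsPn all_in.
    rewrite -leqNgt; apply: leq_trans (_ : #|H| <= _) => //.
    rewrite -(card_codom (@inl_inj H (H * H * 'I_T))).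
    by apply/subset_leq_card/subsetP => x _; have /negPn := all_in x.
  by apply/card_gt0P; exists (exist _ x (etrans (in_setC _ _) xX)).
have [u [uP xu]] := to_core x; have [v [vP yv]] := to_core y.
apply: connect_trans xu (connect_trans (core_connect _ _ uP vP) _).
by rewrite (sym_connect_sym (@adj_sym G')).
Qed.

(** The connectors add four to the degree sum each, and there are at least as
    many of them as pairs of vertices of [H]: the average is at most six. *)
Lemma padded_avg_degree k : 3 <= k -> 1 < #|H| -> 0 < T ->
  (avg_degree padded <= (2 * k)%:R)%R.
Proof.
move=> k_ge3 H_gt1 T_gt0.
have card_padded : #|padded| = #|H| + #|H| * #|H| * T.
  by rewrite card_sum !card_prod card_ord.
have conn_deg (z : H * H * 'I_T) : \sum_(u : H) ends z u <= 2.
  apply: leq_trans (card_ends z); rewrite -sum1_card [leqRHS]big_mkcond /=.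
  apply: leq_sum => u _; have -> : (u \in ends z) = ends z u by [].
  by case: (ends z u).
have sum_conn : \sum_(z : H * H * 'I_T) \sum_(u : H) ends z u
    <= #|H| * #|H| * T * 2.
  apply: leq_trans (leq_sum _ (fun z _ => conn_deg z)) _.
  by rewrite sum_nat_const !card_prod card_ord.
have sum_core : \sum_(u : H) \sum_(v : H) adj u v <= #|H| * #|H|.
  rewrite -sum_nat_const; apply: leq_sum => u _.
  by rewrite -sum1_card; apply: leq_sum => v _; case: (adj u v).
rewrite /avg_degree ler_pdivrMr ?ltr0n ?card_padded; last by nia.
rewrite -natrM ler_nat.
under eq_bigr => x _ do rewrite degreeE.
rewrite big_sumType /=.
under eq_bigr => x _ do rewrite big_sumType /=.
under [X in _ + X]eq_bigr => x _ do rewrite big_sumType /= big1_eq addn0.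
rewrite big_split /= [X in _ + X + _]exchange_big /=.
apply: (@leq_trans (6 * (#|H| + #|H| * #|H| * T))); last by rewrite leq_mul2r; lia.
have : #|H| * #|H| <= #|H| * #|H| * T by rewrite leq_pmulr.
move: sum_conn sum_core; move: (\sum_z _) (\sum_u _) => a b.
move: (#|H| * #|H|) => h2; move: (h2 * T) => N.
by lia.
Qed.

End Padding.

(** * Odd cycles through all remaining vertices *)

Section Tour.
Variables (H : sgraph) (T : nat) (copy : H * H -> 'I_T) (start : H).

Definition connector (u v : H) : padded H T := inr (u, v, copy (u, v)).

(** A closed walk from [u] through [vs] to [start], with a connector between
    any two stops; [u] and the final [start] are left out of the list. *)
Fixpoint tour (u : H) (vs : seq H) : seq (padded H T) :=
  if vs is v :: vs' then connector u v :: inl v :: tour v vs'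
  else [:: connector u start].

Lemma size_tour u vs : size (tour u vs) = (size vs).*2.+1.
Proof. by elim: vs u => //= v vs IHvs u; rewrite IHvs. Qed.

Lemma mem_tour_core u vs x : (inl x \in tour u vs) = (x \in vs).
Proof. by elim: vs u => [|v vs IHvs] u //=; rewrite !inE IHvs. Qed.

(** A connector in the tour determines the stop before it, so distinct stops
    yield distinct connectors. *)
Lemma mem_tour_connector u vs z : inr z \in tour u vs ->
  z.1.1 \in u :: vs /\ z.2 = copy z.1.
Proof.
elim: vs u => [|v vs IHvs] u /=.
  by rewrite inE => /eqP[->]; rewrite mem_head.
rewrite !inE /= => /orP[/eqP[->]|/IHvs[]]; first by rewrite eqxx.
by rewrite inE => -> ->; rewrite orbT.
Qed.

Lemma tour_uniq u vs : uniq (u :: vs) -> uniq (tour u vs).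
Proof.
elim: vs u => [|v vs IHvs] u //= /andP[u_out vs_uniq].
rewrite IHvs // mem_tour_core andbT; case/andP: vs_uniq => -> _; rewrite andbT.
by rewrite inE /=; apply: contra u_out => /mem_tour_connector[].
Qed.

Lemma tour_path u vs : uniq (start :: u :: vs) ->
  path (@adj (padded H T)) (inl u) (rcons (tour u vs) (inl start)).
Proof.
rewrite /= inE negb_or -andbA.
elim: vs u => [|v vs IHvs] u /and4P[su s_out u_out vs_uniq] /=.
  by rewrite /ends /= far_neq 1?eq_sym // !eqxx orbT.
have uv : u != v by apply: contraNneq u_out => ->; apply: mem_head.
rewrite {1 2}/ends /= far_neq // !eqxx orbT /=.
by apply: IHvs; move: s_out; rewrite inE negb_or => /andP[-> ->].
Qed.

End Tour.

(** A small [X] leaves a non-colorable part of [H], hence an edge [v1 v2] of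
    [H], and at least one connector for each pair.  The cycle that takes this
    edge and then tours the remaining vertices of [H] along connectors has
    length [2 * s - 1] where [s] is the number of these vertices: it is odd,
    bad, and avoids [X]. *)
Lemma padded_hitting_set (H : sgraph) (T q t : nat) (X : {set padded H T}) :
  (forall Y : {set H}, #|Y| <= t -> ~ colorable_on (~: Y) q.+1) -> t < T ->
  hitting_set q.+1 X -> t < #|X|.
Proof.
move=> robust tT hitX; rewrite ltnNge; apply/negP => Xt.
pose Y := [set u | (inl u : padded H T) \in X].
have Yt : #|Y| <= t.
  apply: leq_trans Xt; rewrite -(card_imset _ (@inl_inj H (H * H * 'I_T))).
  by apply/subset_leq_card/subsetP => _ /imsetP[u + ->]; rewrite inE.
have notcol := robust _ Yt.
have [v1 [v2 [v1Y v2Y v12]]] :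
    exists v1 v2, [/\ v1 \in ~: Y, v2 \in ~: Y & adj v1 v2].
  have [/exists_inP[v1 v1Y /exists_inP[v2 v2Y v12]]|none] :=
    boolP [exists v1 in ~: Y, exists v2 in ~: Y, adj v1 v2].
    by exists v1, v2.
  case: notcol; exists (fun=> ord0) => u v uY vY uv; case/negP: none.
  by apply/exists_inP; exists u => //; apply/exists_inP; exists v.
have v12_neq : v1 != v2 by apply: contraTneq v12 => ->; rewrite adj_irrefl.
pose r := [seq v <- enum (~: Y) | v \notin [:: v1; v2]].
have core_uniq : uniq [:: v1, v2 & r].
  by rewrite /= !inE negb_or v12_neq !mem_filter !inE !eqxx orbT /=
    filter_uniq ?enum_uniq.
have core_mem v : (v \in [:: v1, v2 & r]) = (v \in ~: Y).
  rewrite !inE mem_filter mem_enum !inE.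
  have [->|_] /= := eqVneq v v1; first by move: v1Y; rewrite !inE => ->.
  by have [->|_] //= := eqVneq v v2; move: v2Y; rewrite !inE => ->.
have /fin_all_exists[copy copyP] (p : H * H) :
    exists s, (inr (p, s) : padded H T) \notin X.
  by case: p => u v; apply: fresh_connector; apply: leq_ltn_trans tT.
pose c : seq (padded H T) := [:: inl v1, inl v2 & tour copy v1 v2 r].
have c_core v : (inl v \in c) = (v \in ~: Y).
  by rewrite -core_mem !inE mem_tour_core.
have c_gt2 : 2 < size c by rewrite /= size_tour.
have c_uniq : uniq c.
  have /andP[v1_out v2r_uniq] := core_uniq.
  rewrite /= inE !mem_tour_core tour_uniq // andbT; apply/andP; split.
    by move: v1_out; rewrite inE.
  by case/andP: v2r_uniq.
have c_cycle : cycle (@adj (padded H T)) c.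
  by rewrite /= v12 /= tour_path.
pose C := cycle_edges c.
have coverC : cover C = [set x in c] by apply: cover_cycle_edges.
have badC : C \in bad_odd_cycles q.+1 (padded H T).
  rewrite inE cycle_edges_is_cycle // card_cycle_edges //= size_tour /=.
  rewrite odd_double /= chi_gt coverC; apply/colorable_inducedP.
  move/colorable_on_core/(sub_colorable_on _) => col; apply: notcol; apply: col.
  by apply/subsetP => v vY; rewrite !in_set c_core.
move/forall_inP/(_ _ badC)/set0Pn: hitX => [x].
rewrite coverC in_setI in_set => /andP[xX]; case: x xX => [u|z] xX.
  by rewrite c_core !inE xX.
rewrite !inE /= => /mem_tour_connector[_ zE]; have := copyP z.1.
by rewrite -zE -surjective_pairing xX.
Qed.

(** * Packing bounds *)

Section ThickCycles.
Variables (k a : nat) (G : sgraph) (P : {set G}).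
Hypotheses (a_gt0 : 0 < a) (P_le : #|P| <= 2 * a).
(** Giving weight [1 / a] to each vertex of [P] is a fractional hitting set of
    total weight at most two; the packing bounds are weak duality. *)
Hypothesis thick : forall C, C \in bad_odd_cycles k G -> a <= #|P :&: cover C|.

Lemma cardsI_sum (A B : {set G}) : #|A :&: B| = \sum_(v in A) (v \in B).
Proof.
rewrite -sum1_card big_mkcond [RHS]big_mkcond; apply: eq_bigr => v _.
by rewrite inE; case: (v \in A); case: (v \in B).
Qed.

Lemma nu_thick b : nu k b G <= 2 * b.
Proof.
apply/bigmax_leqP => Q /andP[/subsetP Q_bad /forallP Q_pack].
rewrite -(leq_pmul2r a_gt0) -sum_nat_const.
apply: leq_trans (_ : \sum_(C in Q) #|P :&: cover C| <= _).
  by apply: leq_sum => C /Q_bad; apply: thick.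
under eq_bigr => C _ do rewrite cardsI_sum.
rewrite exchange_big /=; apply: leq_trans (_ : \sum_(v in P) b <= _).
  apply: leq_sum => v _; apply: leq_trans (Q_pack v).
  rewrite -sum1_card [leqRHS]big_mkcond [leqLHS]big_mkcond leq_sum // => C _.
  by rewrite inE; case: (C \in Q); case: (v \in cover C).
by rewrite sum_nat_const mulnAC leq_mul2r P_le orbT.
Qed.

Lemma frac_packing_thick (R : realType) (y : {set G} -> R) :
  frac_packing k y -> (\sum_(F in bad_hyperedges k G) y F <= 2)%R.
Proof.
case=> y_ge0 y_pack.
have aR : (0 < a%:R :> R)%R by rewrite ltr0n.
rewrite -(ler_pM2r aR) mulr_suml.
apply: (@le_trans _ _ (\sum_(F in bad_hyperedges k G) y F * #|P :&: F|%:R)%R).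
  apply: ler_sum => F FB; rewrite ler_wpM2l ?y_ge0 // ler_nat.
  by case/imsetP: FB => C /thick + ->.
under eq_bigr => F _ do rewrite cardsI_sum natr_sum mulr_sumr.
rewrite exchange_big /=.
apply: (@le_trans _ _ (\sum_(v in P) 1)%R); last first.
  by rewrite sumr_const -natrM ler_nat.
apply: ler_sum => v _; apply: le_trans (y_pack v).
rewrite [leRHS]big_mkcondr /=; apply: ler_sum => F _.
by case: (v \in F); rewrite ?mulr1 ?mulr0.
Qed.

Lemma frac_nu_thick (R : realType) : (0 <= frac_nu R k G <= 2)%R.
Proof.
have pack0 : frac_packing k (fun _ : {set G} => 0%R : R).
  by split=> // v; rewrite big1.
rewrite /frac_nu; set S := (X in sup X).
have S0 : S 0%R by exists (fun=> 0%R) => //; rewrite big1.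
have S_ub : ubound S 2%R by move=> _ [y yP <-]; apply: frac_packing_thick.
apply/andP; split; last by apply: ge_sup => //; exists 0%R.
by apply: ub_le_sup => //; exists 2%R.
Qed.

End ThickCycles.

Lemma tau_gt k (G : sgraph) t :
  (forall X : {set G}, hitting_set k X -> t < #|X|) -> t < tau k G.
Proof.
by rewrite /tau; case: arg_minnP => [|X hitX _]; [apply: hitting_setT | apply].
Qed.

(** Of the [2 * (q.+3 * m)] points of the core, a bad cycle meets more than
    half, since fewer points leave a colorable subgraph. *)
Lemma bad_cycles_gap (R : realType) q m : 0 < m -> exists G : sgraph,
  [/\ graph_class q.+3 G, m < tau q.+3 G, forall b, nu q.+3 b G <= 2 * b
    & (0 <= frac_nu R q.+3 G <= 2)%R].
Proof.
move=> m_gt0; pose H := core q m; pose G := padded H m.+2.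
have H_gt1 : 1 < #|H| by rewrite card_sum card_ord; nia.
have tauG : m < tau q.+3 G.
  apply: tau_gt => X; apply: (@padded_hitting_set H m.+2 q.+2 m) => //.
  by move=> Y; apply: core_robust.
pose P : {set G} := [set inl (inl p) | p : points q m].
have P_card : #|P| = 2 * (q.+3 * m).
  by rewrite card_imset ?card_ord // => p p' [].
have P_le : #|P| <= 2 * (q.+3 * m).+1 by rewrite P_card leq_mul2l leqnSn.
have thick C : C \in bad_odd_cycles q.+3 G -> q.+3 * m < #|P :&: cover C|.
  rewrite inE => /and3P[_ _]; rewrite chi_gt ltnNge; apply: contra => few.
  apply/colorable_inducedP/padded_colorable_on/few_points_colorable => //.
  apply: leq_trans few.
  have inj : injective (fun p : points q m => inl (inl p) : G) by move=> p p' [].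
  rewrite -(card_imset _ inj); apply/subset_leq_card/subsetP => _ /imsetP[p + ->].
  by rewrite !inE imset_f.
exists G; split=> //; last 2 first.
- by move=> b; apply: nu_thick P_le thick b.
- exact: frac_nu_thick P_le thick R.
split.
- exact: padded_two_connected.
- apply/eqP; rewrite eqn_leq chi_gt; apply/andP; split; last first.
    apply/negP => /colorableP[c cP]; have := @core_robust q m set0 m_gt0.
    rewrite cards0 => /(_ isT); apply.
    by exists (c \o inl) => u v _ _ uv; apply: cP.
  rewrite leqNgt chi_gt negbK padded_colorable //; exact: core_colorable.
- by apply: padded_no_clique => //; apply: core_no_clique.
- exact: padded_avg_degree.
Qed.

Theorem corollary4p3 (R : realType) (k : nat) (hk : 3 <= k) :
  (forall b : nat, 1 <= b -> ~ integral_Erdos_Posa k b (graph_class k)) /\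
  ~ frac_Erdos_Posa R k (graph_class k).
Proof.
case: k hk => [|[|[|q]]] // _.
split=> [b _ [f [f_homo f_bound]]|[f [f_homo f_bound]]].
  have [G [G_class tauG nuG _]] := bad_cycles_gap R q (ltn0Sn (f (2 * b))).
  have := leq_trans (f_bound G G_class) (f_homo _ _ (nuG b)).
  by rewrite leqNgt (ltnW tauG).
have [G [G_class tauG _ /andP[nu_ge0 nu_le2]]] := bad_cycles_gap R q (ltn0Sn (f 2)).
have ceil_le2 : `|Num.ceil (frac_nu R q.+3 G)|%N <= 2.
  rewrite -lez_nat gez0_abs ?ceil_le_int //.
  by rewrite ceil_ge0 (lt_le_trans _ nu_ge0) ?ltrN10.
have := leq_trans (f_bound G G_class) (f_homo _ _ ceil_le2).
by rewrite leqNgt (ltnW tauG).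
Qed.
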